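(* Let $A^{(2)}$ be the $2$-times convolution matrix of $\mathbb{F}_2^n$, let $f:\mathbb{F}_2^n\to\mathbb{F}_2$ be a Boolean function, and let $s$ be a nonnegative integer. Then $f$ is an $s$-plateaued function if and only if $(-1)^f$ is an eigenfunction of the matrix $A^{(2)}$ with eigenvalue $2^{n+s}$.
   Context: For a Boolean function $f:\mathbb{F}_2^n\to\mathbb{F}_2$, the Fourier transform is $\widehat f(x)=\frac{1}{2^{n/2}}\sum_{z\in\mathbb{F}_2^n}(-1)^{f(z)+(x,z)}$ with $(x,z)=x_1z_1+\dots+x_nz_n$. $f$ is $s$-plateaued (for a nonnegative integer $s$) if $\widehat f(x)\in\{0,\pm2^{s/2}\}$ for all $x$. The $2$-times convolution matrix $A^{(2)}=(a_{x,y,z,v})$ of $\mathbb{F}_2^n$ is the $4$-dimensional array with $a_{x,y,z,v}=1$ if $x=y+z+v$ and $0$ otherwise ($x,y,z,v\in\mathbb{F}_2^n$). A function $g:\mathbb{F}_2^n\to\mathbb{C}$, $g\not\equiv0$, is an eigenfunction of $A^{(2)}$ with eigenvalue $\theta\in\mathbb{C}$ if $\sum_{y,z,v}a_{x,y,z,v}g(y)g(z)g(v)=\theta g(x)^3$ for all $x$. Here $(-1)^f$ is the $\{\pm1\}$-valued real function $x\mapsto(-1)^{f(x)}$. *)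

(* Defs.v *)
From HB Require Import structures.
From mathcomp Require Import all_boot all_order all_algebra.
From mathcomp Require Import complex.
From mathcomp Require Import reals exp.

Set Implicit Arguments.
Unset Strict Implicit.
Unset Printing Implicit Defensive.

Import Order.TTheory GRing.Theory Num.Theory.
Local Open Scope ring_scope.

(** F_2^n is ['rV['F_2]_n]; the complex numbers are [R[i]] for [R : realType]. *)

Definition dotF2 (n : nat) (x z : 'rV['F_2]_n) : 'F_2 :=
  \sum_(i < n) x ord0 i * z ord0 i.

(** (-1)^b for b in F_2, through the representative [val b] in {0, 1}. *)
Definition signF2 (R : realType) (b : 'F_2) : R := (-1) ^+ val b.

Definition fourier (R : realType) (n : nat) (f : 'rV['F_2]_n -> 'F_2)
    (x : 'rV['F_2]_n) : R :=
  (2 `^ (n%:R / 2))^-1 * \sum_(z : 'rV['F_2]_n) signF2 R (f z + dotF2 x z).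

Definition plateaued (R : realType) (n s : nat)
    (f : 'rV['F_2]_n -> 'F_2) : Prop :=
  forall x : 'rV['F_2]_n,
    [\/ fourier R f x = 0,
        fourier R f x = 2 `^ (s%:R / 2) |
        fourier R f x = - (2 `^ (s%:R / 2))].

Definition convolution2 (R : realType) (n : nat)
    (x y z v : 'rV['F_2]_n) : R[i] :=
  if x == y + z + v then 1 else 0.

Definition eigenfunction (R : realType) (I : finType)
    (A : I -> I -> I -> I -> R[i]) (g : I -> R[i]) (theta : R[i]) : Prop :=
  (exists x, g x <> 0) /\
  forall x, \sum_y \sum_z \sum_v A x y z v * g y * g z * g v
            = theta * g x ^+ 3.

(* Main.v *)
Require Import Defs.
From HB Require Import structures.
From mathcomp Require Import all_boot all_order all_algebra.
From mathcomp Require Import complex.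
From mathcomp Require Import reals exp ring.

(** The transform h |-> walsh h, h : F_2^n -> R, which is [fourier] without its
    factor 2^(-n/2), turns convolution into multiplication
    ([walsh_convolve3]) and is injective ([walsh_inj]). For g = (-1)^f the
    eigenfunction equation says that the triple convolution of g is
    2^(n+s) g^3, and g^3 = g because g has values 1 and -1. Applying the
    transform, this equation is equivalent to W^3 = 2^(n+s) W pointwise,
    where W = walsh g. As W takes values in a field, it means that at each
    point W = 0 or W^2 = 2^(n+s); in terms of W = 2^(n/2) F, where F is the
    Fourier transform of f, that F is 0 or one of the two square roots
    of 2^s. *)

Set Implicit Arguments.
Unset Strict Implicit.
Unset Printing Implicit Defensive.

Import Order.TTheory GRing.Theory Num.Theory.
Local Open Scope ring_scope.
Local Open Scope complex_scope.

Lemma signF2D (R : realType) (a b : 'F_2) :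
  signF2 R (a + b) = signF2 R a * signF2 R b.
Proof.
rewrite /signF2 -exprD.
by case: a b => [[|[|a]] Ha] [[|[|b]] Hb] //=; rewrite ?expr0 ?expr1 ?sqrrN ?expr1n.
Qed.

Lemma signF2_sqr (R : realType) (a : 'F_2) : signF2 R a ^+ 2 = 1.
Proof. by rewrite /signF2 sqrr_sign. Qed.

Lemma dotF2Dl n (x y z : 'rV['F_2]_n) : dotF2 (x + y) z = dotF2 x z + dotF2 y z.
Proof.
by rewrite /dotF2 -big_split; apply: eq_bigr => i _; rewrite mxE mulrDl.
Qed.

Lemma dotF2C n (x z : 'rV['F_2]_n) : dotF2 x z = dotF2 z x.
Proof. by apply: eq_bigr => i _; rewrite mulrC. Qed.

Lemma dotF2Dr n (x y z : 'rV['F_2]_n) : dotF2 x (y + z) = dotF2 x y + dotF2 x z.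
Proof. by rewrite dotF2C dotF2Dl !(dotF2C x). Qed.

Lemma dotF2_delta n (i : 'I_n) (w : 'rV['F_2]_n) :
  dotF2 (delta_mx ord0 i) w = w ord0 i.
Proof.
rewrite /dotF2 (bigD1 i) //= mxE !eqxx mul1r big1 ?addr0 // => j /negPf ji.
by rewrite mxE ji andbF mul0r.
Qed.

(** If w has a nonzero coordinate i, translating x by the i-th unit vector
    changes the sign of every term, so the sum is its own opposite. *)
Lemma sum_signF2_dotF2 (R : realType) n (w : 'rV['F_2]_n) : w != 0 ->
  \sum_(x : 'rV['F_2]_n) signF2 R (dotF2 x w) = 0.
Proof.
move=> /rV0Pn[i wi]; set S := \sum_x _.
have wi1 : w ord0 i = 1.
  by move: wi; case: (w ord0 i) => [[|[|k]] Hk] //= _; apply: val_inj.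
suff SN : S = - S by apply/eqP; rewrite -eqNr -SN.
rewrite {1}/S (reindex_inj (addrI (delta_mx ord0 i))) /= -sumrN.
apply: eq_bigr => x _.
by rewrite dotF2Dl dotF2_delta wi1 signF2D /signF2 /= expr1 mulN1r.
Qed.

Definition walsh (R : realType) n (h : 'rV['F_2]_n -> R) (x : 'rV['F_2]_n) : R :=
  \sum_z h z * signF2 R (dotF2 x z).

(** Fourier inversion: the inner sums produced by exchanging the summations
    vanish off the diagonal; on it each of the 2^n products of two equal signs
    is 1. *)
Lemma walshK (R : realType) n (h : 'rV['F_2]_n -> R) (u : 'rV['F_2]_n) :
  walsh (walsh h) u = #|{: 'rV['F_2]_n}|%:R * h u.
Proof.
rewrite /walsh; under eq_bigr => x _ do rewrite mulr_suml.
rewrite exchange_big (bigD1 u) //= [X in _ + X]big1 ?addr0; last first.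
  move=> z zu.
  under eq_bigr => x _.
    rewrite -mulrA (dotF2C u) -signF2D -dotF2Dr.
    over.
  rewrite -mulr_sumr sum_signF2_dotF2 ?mulr0 //.
  (* in characteristic 2, z + u is the difference of z and u *)
  have oppF (v : 'rV['F_2]_n) : - v = v.
    by apply/rowP => i; rewrite mxE; case: (v ord0 i) => [[|[|k]] Hk] //; apply: val_inj.
  by rewrite -(oppF u) subr_eq0.
under eq_bigr => x _ do
  rewrite -mulrA (dotF2C u) -expr2 signF2_sqr mulr1.
by rewrite sumr_const mulr_natl.
Qed.

Lemma walsh_inj (R : realType) n (h k : 'rV['F_2]_n -> R) :
  walsh h =1 walsh k -> h =1 k.
Proof.
move=> hk u; have N0 : #|{: 'rV['F_2]_n}|%:R != 0 :> R.
  by rewrite pnatr_eq0 -lt0n; apply/card_gt0P; exists 0.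
apply: (mulfI N0); rewrite -!walshK.
by apply: eq_bigr => x _; rewrite hk.
Qed.

Definition convolve3 (R : realType) n (h : 'rV['F_2]_n -> R) (x : 'rV['F_2]_n) : R :=
  \sum_y \sum_z \sum_v (x == y + z + v)%:R * h y * h z * h v.

(** The character of x is multiplicative, so its value at y + z + v, the only
    point that the indicator selects, splits into one factor for each of the
    three copies of h. *)
Lemma walsh_convolve3 (R : realType) n (h : 'rV['F_2]_n -> R) (x : 'rV['F_2]_n) :
  walsh (convolve3 h) x = walsh h x ^+ 3.
Proof.
rewrite /walsh /convolve3; under eq_bigr => u _ do rewrite mulr_suml.
rewrite exchange_big /= exprS expr2 mulr_suml; apply: eq_bigr => y _.
under eq_bigr => u _ do rewrite mulr_suml.
rewrite exchange_big /= mulr_suml mulr_sumr; apply: eq_bigr => z _.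
under eq_bigr => u _ do rewrite mulr_suml.
rewrite exchange_big /= !mulr_sumr; apply: eq_bigr => v _.
rewrite (bigD1 (y + z + v)) //= eqxx big1 ?addr0; last first.
  by move=> u /negPf->; rewrite !mul0r.
by rewrite mul1r !dotF2Dr !signF2D; ring.
Qed.

(** A function with values in {1, -1} equals its own cube, so the cube in the
    eigenfunction equation disappears and the equation becomes linear in its
    right-hand side; this is what lets the transform apply to both sides. *)
Lemma eigen_walsh (R : realType) n (f : 'rV['F_2]_n -> 'F_2) (t : R) :
  let g := fun x => signF2 R (f x) in
  eigenfunction (@convolution2 R n) (fun x => (g x)%:C) t%:C <->
  forall x, walsh g x ^+ 3 = t * walsh g x.
Proof.
move=> g; have g3 x : g x ^+ 3 = g x by rewrite exprS signF2_sqr mulr1.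
have convE x : \sum_y \sum_z \sum_v
    convolution2 R x y z v * (g y)%:C * (g z)%:C * (g v)%:C = (convolve3 g x)%:C.
  rewrite /convolve3 rmorph_sum; apply: eq_bigr => y _.
  rewrite rmorph_sum; apply: eq_bigr => z _.
  rewrite rmorph_sum; apply: eq_bigr => v _.
  by rewrite !rmorphM rmorph_nat /convolution2; case: eqP.
have walshZ x : walsh (fun y => t * g y) x = t * walsh g x.
  by rewrite /walsh mulr_sumr; apply: eq_bigr => z _; rewrite mulrA.
split=> [[_ eig] x|cub].
  rewrite -walsh_convolve3 -walshZ; apply: eq_bigr => u _; congr (_ * _).
  by apply: complexI; rewrite -convE eig -rmorphXn g3 rmorphM.
split=> [|x].
  exists 0 => /complexI g0; have := signF2_sqr R (f 0).
  by rewrite -/(g 0) g0 expr0n => /eqP; rewrite eq_sym oner_eq0.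
rewrite convE -rmorphXn g3 -rmorphM; congr (_%:C).
apply: (walsh_inj (k := fun y => t * g y)) => u.
by rewrite walsh_convolve3 walshZ.
Qed.

Lemma sqr_powR_half (R : realType) (m : nat) : ((2 : R) `^ (m%:R / 2)) ^+ 2 = 2 ^+ m.
Proof.
by rewrite -powR_mulrn ?powR_ge0 // -powRrM divfK ?pnatr_eq0 // powR_mulrn.
Qed.

Lemma walsh_fourier (R : realType) n (f : 'rV['F_2]_n -> 'F_2) x :
  walsh (fun z => signF2 R (f z)) x = 2 `^ (n%:R / 2) * fourier R f x.
Proof.
rewrite /fourier mulVKf ?gt_eqF ?powR_gt0 //.
by apply: eq_bigr => z _; rewrite signF2D.
Qed.

Theorem theorem6 (R : realType) (n : nat) (f : 'rV['F_2]_n -> 'F_2) (s : nat) :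
  plateaued R s f <->
  eigenfunction (@convolution2 R n)
    (fun x : 'rV['F_2]_n => (signF2 R (f x))%:C) (2 ^+ (n + s)).
Proof.
have -> : 2 ^+ (n + s) = (2 ^+ (n + s))%:C :> R[i] by rewrite rmorphXn rmorph_nat.
apply: iff_sym; apply: (iff_trans (eigen_walsh f _)).
(* W^3 = 2^(n+s) W, divided by 2^(3n/2), is F (F^2 - 2^s) = 0 *)
have cubeP x : (walsh (fun z => signF2 R (f z)) x ^+ 3 ==
                2 ^+ (n + s) * walsh (fun z => signF2 R (f z)) x) =
    [|| fourier R f x == 0, fourier R f x == 2 `^ (s%:R / 2)
      | fourier R f x == - 2 `^ (s%:R / 2)].
  have c0 : (2 : R) `^ (n%:R / 2) != 0 by rewrite gt_eqF ?powR_gt0.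
  rewrite walsh_fourier exprD -!sqr_powR_half.
  set c := _ `^ _ in c0 *; set F := fourier R f x; set r := _ `^ _.
  rewrite -subr_eq0.
  have -> : (c * F) ^+ 3 - c ^+ 2 * r ^+ 2 * (c * F) = c ^+ 3 * (F * (F ^+ 2 - r ^+ 2)) by ring.
  by rewrite mulf_eq0 expf_eq0 (negPf c0) /= mulf_eq0 subr_eq0 eqf_sqr.
split=> H x.
  by have /eqP := H x; rewrite cubeP => /or3P[] /eqP;
    [apply: Or31 | apply: Or32 | apply: Or33].
by apply/eqP; rewrite cubeP; case: (H x) => ->; rewrite eqxx ?orbT.
Qed.
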